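(* There are at most $16(\phi(l)-1)$ isomorphism classes of $l$-reflexive polygons, where $\phi$ is Euler's totient function.
   Context: Here $l$ is a positive integer. Let $N\cong\mathbb{Z}^2$ be a lattice with dual lattice $M=\mathrm{Hom}(N,\mathbb{Z})$. A polygon here is a 2-dimensional convex lattice polytope $P\subset N\otimes_{\mathbb{Z}}\mathbb{Q}$, i.e. its vertices lie in $N$. A nonzero lattice point $x$ is primitive if the segment from $\mathbf{0}$ to $x$ contains no lattice points other than its endpoints. If $P$ has the origin in its interior and $F$ is a facet (edge) of $P$, the primitive outer normal of $F$ is the unique primitive $u_F\in M$ such that $F=\{x\in P\mid\langle u_F,x\rangle=l_F\}$ for some positive integer $l_F$, called the local index of $F$. $P$ is $l$-reflexive if it contains the origin in its interior, all its vertices are primitive, and $l_F=l$ for every facet $F$. Two lattice polytopes $P\subset N_{\mathbb{Q}}$ and $P'\subset N'_{\mathbb{Q}}$ are isomorphic if there is an affine lattice isomorphism $N\cong N'$ mapping the vertex set of $P$ onto that of $P'$.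
   Formalization: The formal theorem assumes l > 1: for l = 1 the stated bound is 16(φ(1)−1) = 0, although 1-reflexive polygons exist (for example the triangle with vertices e1, e2, −e1−e2), so the claim fails exactly there. *)

(* Defs.v *)
From mathcomp Require Import all_boot all_order all_algebra.
From mathcomp Require Import all_classical topology normedtype convex.

Set Implicit Arguments.
Unset Strict Implicit.
Unset Printing Implicit Defensive.

Import Order.TTheory GRing.Theory Num.Theory.
Import numFieldTopology.Exports numFieldNormedType.Exports.

Local Open Scope classical_set_scope.
Local Open Scope ring_scope.

(* The lattice N is 'cV[int]_2, its dual M is 'rV[int]_2 (a row acts by matrix
   product), and N_Q, M_Q are the corresponding spaces over rat. *)

Definition toQ m n (x : 'M[int]_(m, n)) : 'M[rat]_(m, n) := map_mx intr x.

Definition pairing (u : 'rV[rat]_2) (x : 'cV[rat]_2) : rat := (u *m x) 0 0.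

Definition primitive m n (x : 'M[int]_(m, n)) : Prop :=
  x != 0 /\
  forall (y : 'M[int]_(m, n)) (t : rat),
    0 <= t <= 1 -> toQ y = t *: toQ x -> y = 0 \/ y = x.

Definition convex_hull (S : set 'cV[rat]_2) : set 'cV[rat]_2 :=
  smallest [set C | convex_set C] S.

Definition polytope (P : set 'cV[rat]_2) : Prop :=
  exists2 S, finite_set S & P = convex_hull S.

(* S is nonempty and its affine hull x0 + W has dimension d: W is the least
   subspace containing all differences x - x0 with x in S. *)
Definition has_dim (S : set 'cV[rat]_2) (d : nat) : Prop :=
  exists x0 : 'cV[rat]_2, exists W : {vspace 'cV[rat]_2},
    [/\ S x0, \dim W = d, (forall x, S x -> x - x0 \in W)
      & forall U : {vspace 'cV[rat]_2},
          (forall x, S x -> x - x0 \in U) -> (W <= U)%VS].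

Definition face (P F : set 'cV[rat]_2) : Prop :=
  exists u : 'rV[rat]_2,
    F = [set x | P x /\ forall y, P y -> pairing u y <= pairing u x].

Definition vertex (P : set 'cV[rat]_2) (v : 'cV[rat]_2) : Prop :=
  face P [set v].

Definition facet (P F : set 'cV[rat]_2) : Prop := face P F /\ has_dim F 1.

Definition lattice_polygon (P : set 'cV[rat]_2) : Prop :=
  [/\ polytope P, has_dim P 2
    & forall v, vertex P v -> exists x : 'cV[int]_2, v = toQ x].

(* u is the primitive outer normal of the facet F and k its local index. *)
Definition outer_normal (P F : set 'cV[rat]_2) (u : 'rV[int]_2) (k : nat) :
    Prop :=
  [/\ primitive u, (0 < k)%N
    & F = [set x | P x /\ pairing (toQ u) x = k%:R]].

(* rat^o is rat with the topology given by its absolute value. *)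
Definition l_reflexive (l : nat) (P : set 'cV[rat]_2) : Prop :=
  [/\ lattice_polygon P,
      interior (P : set 'cV[rat^o]_2) 0,
      forall x : 'cV[int]_2, vertex P (toQ x) -> primitive x
    & forall F, facet P F -> exists u : 'rV[int]_2, outer_normal P F u l].

Definition lattice_vertices (P : set 'cV[rat]_2) : set 'cV[int]_2 :=
  [set x | vertex P (toQ x)].

(* The affine automorphisms of the lattice are x |-> A x + b with A in GL_2(Z). *)
Definition isomorphic (P P' : set 'cV[rat]_2) : Prop :=
  exists A : 'M[int]_2, exists b : 'cV[int]_2,
    A \in unitmx /\
    [set A *m x + b | x in lattice_vertices P] = lattice_vertices P'.

Definition iso_classes (l : nat) : set (set (set 'cV[rat]_2)) :=
  [set [set Q | l_reflexive l Q /\ isomorphic P Q] | P in l_reflexive l].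

(* Main.v *)
(* Let P be an l-reflexive polygon, v a vertex and w the primitive direction of the edge leaving v
   counterclockwise.  Since v is primitive, the index l sublattice spanned by v and w is
   {x | l divides det (v, x)}, so it is also spanned by the next vertex and the next edge direction:
   all vertices of P lie in one sublattice, in which P is a reflexive polygon.

   In the coordinates given by (v, w), walking around P is the recursion v' = v + m w,
   w' = w - c v' with m, c >= 1.  Because every vertex satisfies every edge inequality, m, c <= 4,
   and a finite search over these walks finds 16 reflexive polygons up to GL_2(Z).

   Each of the 16 has coordinates in which (1, 0) is a vertex, (0, 1) is an edge direction and
   (1, 1) is a vertex or an edge direction.  The original lattice is obtained from the sublattice by
   adding (w + k v) / l for some k modulo l; primitivity of w and of v + w forces both k and k - 1
   to be prime to l, which leaves at most phi(l) - 1 values of k. *)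
Require Import Defs.
From mathcomp Require Import all_boot all_order all_algebra zify ring lra.
From mathcomp Require Import all_classical topology normedtype convex interval_inference.

Set Implicit Arguments.
Unset Strict Implicit.
Unset Printing Implicit Defensive.

Import Order.TTheory GRing.Theory Num.Theory.
Import numFieldTopology.Exports numFieldNormedType.Exports.

Local Open Scope classical_set_scope.
Local Open Scope card_scope.
Local Open Scope ring_scope.

(** * Sequences of plane vectors turning left *)

Definition vec := (int * int)%type.
Definition det (x y : vec) : int := x.1 * y.2 - x.2 * y.1.
Definition dot (x y : vec) : int := x.1 * y.1 + x.2 * y.2.
Definition ray (x : vec) (t : int) (y : vec) : vec := (x.1 + t * y.1, x.2 + t * y.2).
Definition opp (x : vec) : vec := (- x.1, - x.2).
Definition comb (v w p : vec) : vec := ray (p.1 * v.1, p.1 * v.2) p.2 w.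

Lemma det_comb (v w p q : vec) : det (comb v w p) (comb v w q) = det p q * det v w.
Proof. by rewrite /det /=; ring. Qed.

(* Half-open: the boundary ray through [x] is included, the opposite one is not. *)
Definition half_plane (x y : vec) : bool :=
  (0 < det y x) || (det y x == 0) && (0 < dot y x).

Lemma vec_eq0 (x : vec) : dot x x = 0 -> x = (0, 0).
Proof. by case: x => a b; rewrite /dot /= => h; congr pair; nia. Qed.

Lemma dot_gt0 (x : vec) : x != (0, 0) -> 0 < dot x x.
Proof.
move=> x0; have: dot x x != 0 by apply: contra_neq x0 => /vec_eq0.
by rewrite /dot; nia.
Qed.

(** The squares of [dot] and [det] add up to the product of the squared norms, so the two do not
    vanish together. *)
Lemma half_plane_split (x y : vec) :
  x != (0, 0) -> y != (0, 0) -> ~~ half_plane x y -> half_plane (opp x) y.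
Proof.
move=> /dot_gt0 x0 /dot_gt0 y0; rewrite /half_plane.
have -> : det y (opp x) = - det y x by rewrite /det /=; ring.
have -> : dot y (opp x) = - dot y x by rewrite /dot /=; ring.
have e : dot y x * dot y x + det y x * det y x = dot x x * dot y y.
  by rewrite /dot /det; ring.
move: (det y x) (dot y x) (dot x x) (dot y y) x0 y0 e => d e a b a0 b0 h; nia.
Qed.

Lemma dotC (x y : vec) : dot x y = dot y x.
Proof. by rewrite /dot; ring. Qed.

(** The ray through [x] comes last in counterclockwise order, so a vector with a left turn inside
    the half-plane is off that ray. There the three-term identity [e] decides the sign. *)
Lemma half_plane_trans (x y0 y1 y2 : vec) : x != (0, 0) ->
  half_plane x y0 -> half_plane x y1 -> half_plane x y2 ->
  0 < det y0 y1 -> 0 < det y1 y2 -> 0 < det y0 y2.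
Proof.
move=> /dot_gt0 xx; rewrite /half_plane => h0 h1 h2 d01 d12.
have e : det y0 y2 * det y1 x = det y0 y1 * det y2 x + det y1 y2 * det y0 x.
  by rewrite /det; ring.
have f a b : det a b * dot x x = dot a x * det x b + det a x * dot x b.
  by rewrite /det /dot; ring.
have N a b : det a b = - det b a by rewrite /det; ring.
have p01 := f y0 y1; have p12 := f y1 y2.
rewrite (N x) in p01; rewrite (N x) in p12.
have g0 : 0 <= det y0 x by move: h0; case: ltgtP.
have g1 : 0 <= det y1 x by move: h1; case: ltgtP.
have g2 : 0 <= det y2 x by move: h2; case: ltgtP.
move: xx p01 p12 e d01 d12 g0 g1 g2 h0 h1 h2.
rewrite (dotC x y1) (dotC x y2).
move: (det y0 x) (det y1 x) (det y2 x) (dot y0 x) (dot y1 x) (dot y2 x).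
move: (det y0 y1) (det y1 y2) (det y0 y2) (dot x x) => d01 d12 d02 n a0 a1 a2 t0 t1 t2.
move=> n0 p01 p12 e d01p d12p g0 g1 g2 h0 h1 h2.
have [a1p|a1z] : 0 < a1 \/ a1 = 0 by lia.
  have [s0|s0] : 0 < d01 * a2 + d12 * a0 \/ a0 = 0 /\ a2 = 0 by nia.
    by rewrite -e pmulr_lgt0 in s0.
  by case: s0 => z0 z2; rewrite z0 /= in h0 p01; nia.
have z0 : a0 = 0 by rewrite a1z in e; nia.
by rewrite a1z z0 in p01; nia.
Qed.

(* Inside a half-open half-plane, [0 < det _ _] is transitive, so a sequence staying there is
   injective, against finiteness. *)
Lemma leave_half_plane (s : nat -> vec) (r : seq vec) (x : vec) (i : nat) :
  (forall j, s j \in r) -> (forall j, 0 < det (s j) (s j.+1)) -> x != (0, 0) ->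
  half_plane x (s i) -> exists2 j, half_plane x (s j) & ~~ half_plane x (s j.+1).
Proof.
move=> sr turn x0 hi.
have [/existsP[j /andP[]]|] :=
  boolP [exists j : 'I_(i + size r).+1, half_plane x (s j) && ~~ half_plane x (s j.+1)].
  by exists j.
rewrite negb_exists => /forallP stay; exfalso.
have hs k : (k <= size r)%N -> half_plane x (s (i + k)%N).
  elim: k => [|k IH] kr; first by rewrite addn0.
  have jb : (i + k < (i + size r).+1)%N by lia.
  by have := stay (Ordinal jb); rewrite /= IH ?(ltnW kr) //= negbK addnS.
have up k j : (j + k < size r)%N -> 0 < det (s (i + j)%N) (s (i + j + k).+1).
  elim: k => [|k IH] b; first by rewrite addn0.
  have b' : (j + k < size r)%N by lia.
  apply: (@half_plane_trans x _ (s (i + j + k).+1)) => //.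
  - by apply: hs; lia.
  - by rewrite -addnA -addnS; apply: hs; lia.
  - by rewrite -addnA -addnS; apply: hs; lia.
  - exact: IH.
  - by rewrite addnS.
have inj : uniq [seq s (i + k)%N | k <- iota 0 (size r).+1].
  rewrite map_inj_in_uniq ?iota_uniq // => j k; rewrite !mem_iota => jr kr.
  have dd y : det y y = 0 by rewrite /det; ring.
  wlog jk : j k jr kr / (j < k)%N.
    move=> W e; have [jk|kj|//] := ltngtP j k; first exact: W.
    by symmetry; apply: W => //; rewrite e.
  have := @up (k - j.+1)%N j; rewrite (_ : (i + j + (k - j.+1)).+1 = (i + k)%N); last by lia.
  by move=> + e; rewrite e dd => /(_ ltac:(lia)).
have := uniq_leq_size inj (s2 := r); rewrite size_map size_iota ltnn => F.
suff /F : {subset [seq s (i + k)%N | k <- iota 0 (size r).+1] <= r} by [].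
by move=> _ /mapP[k _ ->].
Qed.

(** The sequence can stay neither in the half-plane of [x] nor in the opposite one, so it enters the
    first and leaves it again. A left turn is less than a half turn, so the exit does not land on
    the ray opposite to [x]. *)
Lemma turning_cover (s : nat -> vec) (r : seq vec) (x : vec) :
  (forall j, s j \in r) -> (forall j, 0 < det (s j) (s j.+1)) -> x != (0, 0) ->
  exists i, 0 <= det (s i) x /\ det (s i.+1) x < 0.
Proof.
move=> sr turn x0.
have s0 j : s j != (0, 0).
  by apply/eqP => e; have := turn j; rewrite e /det /= !mul0r.
have ox0 : opp x != (0, 0).
  by apply: contra_neq x0; case: (x) => a b [ha hb]; congr pair; lia.
have [i hi] : exists i, half_plane x (s i).
  have [h|h] := boolP (half_plane x (s 0)); first by exists 0%N.
  have [j _ hj] := leave_half_plane sr turn ox0 (half_plane_split x0 (s0 _) h).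
  exists j.+1; have := half_plane_split ox0 (s0 _) hj.
  by rewrite /opp /= !opprK -surjective_pairing.
have [j hj hj1] := leave_half_plane sr turn x0 hi.
exists j; split; first by move: hj; rewrite /half_plane; lia.
have := half_plane_split x0 (s0 _) hj1; have := turn j.
move: hj hj1; rewrite /half_plane.
have -> : det (s j.+1) (opp x) = - det (s j.+1) x by rewrite /det /=; ring.
have -> : dot (s j.+1) (opp x) = - dot (s j.+1) x by rewrite /dot /=; ring.
have e : det (s j) (s j.+1) * dot x x =
    - dot (s j) x * det (s j.+1) x + det (s j) x * dot (s j.+1) x.
  by rewrite /det /dot; ring.
have xx := dot_gt0 x0.
move: (det (s j.+1) x) (dot (s j.+1) x) (det (s j) x) (dot (s j) x) (dot x x) e xx.
move: (det (s j) (s j.+1)) => q d1 t1 d t n.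
nia.
Qed.

(** * Walks around reflexive polygons *)

(* Vertices and primitive edge directions of a reflexive polygon in counterclockwise order, in the
   basis formed by the first ones; [det _ (W i) <= 1] is the inequality of the i-th edge. *)
Record walk (V W : nat -> vec) (m c : nat -> int) (r : seq vec) : Prop := Walk {
  walkV0 : V 0%N = (1, 0);
  walkW0 : W 0%N = (0, 1);
  walkV : forall i, V i.+1 = ray (V i) (m i) (W i);
  walkW : forall i, W i.+1 = ray (W i) (- c i) (V i.+1);
  walkm : forall i, 0 < m i;
  walkc : forall i, 0 < c i;
  walk_fin : forall i, V i \in r;
  walk_le1 : forall i j, det (V j) (W i) <= 1;
  walk_strict : forall i, det (V 0%N) (W i) = 1 -> V 0%N = V i \/ V 0%N = V i.+1;
  walk_det : forall n, V n = V 0%N -> W n = W 0%N }.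

Lemma walk_basis V W m c r i : walk V W m c r -> det (V i) (W i) = 1.
Proof.
move=> h; elim: i => [|i IH]; first by rewrite (walkV0 h) (walkW0 h).
rewrite (walkW h) (walkV h) -IH /det /=; ring.
Qed.

Lemma walk_turn V W m c r i : walk V W m c r -> det (V i) (V i.+1) = m i.
Proof.
by move=> h; rewrite (walkV h) -[RHS]mulr1 -(walk_basis i h) /det /=; ring.
Qed.

(** The edge is the one whose cone contains [x]: on that cone its functional is positive. Applied to
    well-chosen [x], this supplies the edge inequalities that bound [c] and [m]. *)
Lemma walk_functional V W m c r x : walk V W m c r -> x != (0, 0) ->
  exists2 i, 0 < det x (W i) & det (V i.+1) x < 0.
Proof.
move=> h x0; have tn i : 0 < det (V i) (V i.+1) by rewrite (walk_turn i h) (walkm h).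
have [i [h1 h2]] := turning_cover (walk_fin h) tn x0; exists i => //.
have e : m i * det x (W i) = det (V i) x - det (V i.+1) x.
  rewrite (walkV h) /det /=.
  rewrite -[X in m i * X]mulr1 -[X in _ = X]mulr1 -(walk_basis i h) /det; ring.
have := walkm h i; nia.
Qed.

(** An edge facing away from [V i.+1] has a value [t <= -1] there. Its inequality at the two
    neighbouring vertices also holds one primitive step along each edge, and the sum gives
    [- c i * t <= 2 - 2 * t], so [c i] is at most 2 + 2/|t|. *)
Lemma walk_c_le4 V W m c r i : walk V W m c r -> c i <= 4.
Proof.
move=> h; have basis := walk_basis i.+1 h.
have v0 : opp (V i.+1) != (0, 0).
  by apply/eqP => -[e1 e2]; move: basis; rewrite /det; nia.
have [k up _] := walk_functional h v0.
have lo := walk_le1 h k i; have hi := walk_le1 h k i.+2.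
have eV := walkV h i; have mi := walkm h i; have mi' := walkm h i.+1.
have e1 : det (V i.+1) (W k) = det (V i) (W k) + m i * det (W i) (W k).
  by rewrite eV /det /=; ring.
have e2 : det (V i.+2) (W k) =
    det (V i.+1) (W k) + m i.+1 * (det (W i) (W k) - c i * det (V i.+1) (W k)).
  by rewrite (walkV h i.+1) (walkW h i) /det /=; ring.
have e3 : det (opp (V i.+1)) (W k) = - det (V i.+1) (W k) by rewrite /det /=; ring.
rewrite {}e3 in up; rewrite {}e2 in hi.
move: up lo hi e1; move: (det (V i.+1) _) (det (V i) _) (det (W i) _) => t a p.
move=> t0 a1 hi e; have p0 : t - p <= 1 by nia.
have p1 : p - c i * t <= 1 - t by nia.
nia.
Qed.

(** The edges [k1] and [k2] bound the polygon forwards and backwards along [W i]. The vertex [y] has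
    coordinates [(a, b)] in the basis [V i], [W i], with [a <= -1]; comparing widths at [y] and at
    edge [i] gives [- a * m i <= 2 - 2 * a]. *)
Lemma walk_m_le4 V W m c r i : walk V W m c r -> m i <= 4.
Proof.
move=> h; have basis := walk_basis i h.
have w0 : W i != (0, 0).
  by apply/eqP => e; move: basis; rewrite e /det /=; nia.
have ow0 : opp (W i) != (0, 0).
  by apply: contra_neq w0; case: (W i) => a b [ha hb]; congr pair; lia.
have [k1 p1 py] := walk_functional h w0; have [k2 p2 _] := walk_functional h ow0.
have e2 : det (opp (W i)) (W k2) = - det (W i) (W k2) by rewrite /det /=; ring.
rewrite {}e2 in p2; set y := V k1.+1 in py.
have ey u : det y u = det y (W i) * det (V i) u + det (V i) y * det (W i) u.
  by rewrite -[LHS]mulr1 -basis /det; ring.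
have eV u : det (V i.+1) u = det (V i) u + m i * det (W i) u.
  by rewrite (walkV h) /det /=; ring.
have a1 := walk_le1 h k1 i.+1; have a2 := walk_le1 h k1 k1.+1.
have b1 := walk_le1 h k2 i; have b2 := walk_le1 h k2 k1.+1.
rewrite eV in a1; rewrite -/y ey in a2; rewrite -/y ey in b2.
move: p1 p2 py a1 a2 b1 b2; move: (det y _) (det (V i) y) => a b.
move: (det (W i) (W k1)) (det (W i) (W k2)) (det (V i) (W k1)) (det (V i) (W k2)).
move=> w1 w2 v1 v2 w1p w2n an a1 a2 b1 b2; move: (m i) a1 => n a1.
have s1 : (b - a * n) * w1 <= 1 - a by nia.
have s2 : b * w2 <= 1 - a by nia.
have t1 : b - a * n <= 1 - a by nia.
have t2 : - b <= 1 - a by nia.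
nia.
Qed.

(* Vertex sets of the 16 reflexive polygons, in coordinates where (1, 0) is a vertex, (0, 1) an edge
   direction and (1, 1) a vertex or an edge direction. *)
Definition models : seq (seq vec) :=
 [:: [:: (-1, -1); (-1, 0); (0, -1); (0, 1); (1, 0); (1, 1)];
     [:: (-2, -1); (-1, -1); (-1, 0); (1, 0); (1, 1)];
     [:: (-2, -1); (0, -1); (0, 1); (1, 0); (1, 1)];
     [:: (-2, -1); (-1, -1); (0, 1); (1, 0); (1, 1)];
     [:: (-3, -2); (-2, -1); (1, 0); (1, 1)];
     [:: (-3, -2); (0, 1); (1, 0); (1, 1)];
     [:: (-2, -1); (-1, -1); (1, 0); (1, 1)];
     [:: (-3, -2); (-1, 0); (1, 0); (1, 1)];
     [:: (-2, -3); (0, 1); (1, 0); (1, 2)];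
     [:: (-1, -1); (-1, 0); (1, 0); (1, 1)];
     [:: (-3, -2); (1, 0); (1, 1)];
     [:: (-5, -3); (1, 0); (1, 1)];
     [:: (-2, -1); (1, 0); (1, 1)];
     [:: (-1, -2); (-1, 0); (1, 0); (1, 2)];
     [:: (-3, -4); (1, 0); (1, 2)];
     [:: (-2, -3); (1, 0); (1, 3)]]%Z.

(** Vertices and edge directions of either sign are primitive in the original lattice too, so a
    basis [v], [w] found here has [v], [w] and their sum primitive there. *)
Definition has_model (vs ws : seq vec) : bool :=
  let dirs := ws ++ map opp ws in
  has (fun C => has (fun v => has (fun w =>
    [&& ray v 1 w \in vs ++ dirs, `|det v w| == 1 & perm_eq vs (map (comb v w) C)])
    dirs) vs) models.

(* If the start (1, 0) is on the line of the current edge, then it is the end of that edge.  The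
   boolean connectives are strict under [vm_compute]; the conditionals make the search prune. *)
Fixpoint search (ts : seq int) (n : nat) (vs ws : seq vec) (v w : vec) : bool :=
  if n isn't n'.+1 then false else
  let vs' := v :: vs in let ws' := w :: ws in
  all (fun m => let v' := ray v m w in
    if v' == (1, 0)
    then all (fun c =>
      if ray w (- c) v' == (0, 1) then has_model vs' ws' else true) ts
    else if (v != (1, 0)) && (det (1, 0) w == 1) then true
    else if has (fun y => 1 < det v' y) ws' then true
    else all (fun c => let w' := ray w (- c) v' in
      if has (fun y => 1 < det y w') (v' :: vs') then true
      else search ts n' vs' ws' v' w') ts)
    ts.

(** One branch of the search follows the given walk, and each test that prunes a branch contradicts
    a property of walks. The lists are reversed because the search pushes at the head. *)
Lemma search_sound V W m c r ts n i : walk V W m c r ->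
  (forall t, (t \in ts) = (0 < t <= 4)) ->
  search ts n (rev (mkseq V i)) (rev (mkseq W i)) (V i) (W i) ->
  exists k, [/\ (0 < k)%N, V k = V 0%N & has_model (rev (mkseq V k)) (rev (mkseq W k))].
Proof.
move=> h mem_ts; elim: n i => [//|n IH] i; rewrite /search -/search.
rewrite -!rev_rcons -!mkseqS => /allP/(_ (m i)).
rewrite mem_ts (walkm h) (walk_m_le4 _ h) => /(_ isT).
rewrite -(walkV h); case: eqP => [e|ne].
  move=> /allP/(_ (c i)).
  rewrite mem_ts (walkc h) (walk_c_le4 _ h) => /(_ isT).
  rewrite -(walkW h).
  have e0 : V i.+1 = V 0%N by rewrite e (walkV0 h).
  by rewrite (walk_det h e0) (walkW0 h) eqxx => H; exists i.+1.
case: ifP => [/andP[/eqP vi /eqP d] _|_].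
  case: (@walk_strict _ _ _ _ _ h i).
  + by rewrite (walkV0 h).
  + by rewrite (walkV0 h) => e; case: vi.
  + by rewrite (walkV0 h) => e; case: ne.
case: ifP => [/hasP[y]|_].
  rewrite mem_rev => /mapP[j _ ->].
  by rewrite ltNge (walk_le1 h).
move=> /allP/(_ (c i)).
rewrite mem_ts (walkc h) (walk_c_le4 _ h) => /(_ isT).
rewrite -(walkW h); case: ifP => [/hasP[y]|_]; last exact: IH.
rewrite -rev_rcons -mkseqS mem_rev => /mapP[j _ ->].
by rewrite ltNge (walk_le1 h).
Qed.

Lemma walk_has_model V W m c r : walk V W m c r ->
  exists k, [/\ (0 < k)%N, V k = V 0%N & has_model (rev (mkseq V k)) (rev (mkseq W k))].
Proof.
(* Running out of fuel counts as failure, so success with fuel 6 also shows that every walk closes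
   after at most six edges. *)
move=> h; apply: (@search_sound V W m c r [:: 1; 2; 3; 4] 6 0 h).
  by move=> t; rewrite !inE; lia.
by rewrite (walkV0 h) (walkW0 h); vm_compute.
Qed.

(** * From index l to index 1 *)

Lemma det_self (x : vec) : det x x = 0.
Proof. by rewrite /det; ring. Qed.

Lemma det_rayl (x y z : vec) t : det (ray x t y) z = det x z + t * det y z.
Proof. by rewrite /det /=; ring. Qed.

Lemma det_rayr (x y z : vec) t : det z (ray x t y) = det z x + t * det z y.
Proof. by rewrite /det /=; ring. Qed.

Lemma coprime_multiple (v d : vec) :
  coprimez v.1 v.2 -> det v d = 0 -> exists t, d = (t * v.1, t * v.2).
Proof.
case: v d => [a b] [x y] /=; rewrite /det /= => /coprimezP[[p q] /= e] h.
exists (p * x + q * y); congr pair; apply/eqP; rewrite -subr_eq0.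
  have -> : x - (p * x + q * y) * a = x * (1 - (p * a + q * b)) - q * (a * y - b * x).
    by ring.
  by rewrite e h; apply/eqP; ring.
have -> : y - (p * x + q * y) * b = y * (1 - (p * a + q * b)) + p * (a * y - b * x).
  by ring.
by rewrite e h; apply/eqP; ring.
Qed.

(** An integral description of the vertex set of an [l]-reflexive polygon. [reflexive_strict] keeps
    a vertex out of the triangle of the origin and two other vertices, with denominators cleared; an
    edge normal is encoded by the edge direction [w], as the functional [det _ w]. *)
Record reflexive_set (l : int) (r : seq vec) (S : vec -> Prop) : Prop := ReflexiveSet {
  reflexive_gt0 : 0 < l;
  reflexive_ex : exists v, S v;
  reflexive_fin : forall v, S v -> v \in r;
  reflexive_coprime : forall v, S v -> coprimez v.1 v.2;
  reflexive_strict : forall x y z (a b d : int), S x -> S y -> S z ->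
    0 <= a -> 0 <= b -> 0 < d -> a + b <= d ->
    d * x.1 = a * y.1 + b * z.1 -> d * x.2 = a * y.2 + b * z.2 -> x = y \/ x = z;
  reflexive_edge : forall v, S v -> exists w m,
    [/\ S (ray v m w), 0 < m, coprimez w.1 w.2, det v w = l
      & forall y, S y -> det y w <= l] }.

(** Both [w i] and [w i.+1] have determinant [l] with the primitive [v i.+1], so they differ by a
    multiple of it. The inequality of edge [i.+1] at [v i] gives [0 <= c i]; if [c i] were 0,
    [v i.+1] would lie strictly between its neighbours. *)
Lemma reflexive_boundary l r S : reflexive_set l r S ->
  exists (v w : nat -> vec) (m c : nat -> int),
  [/\ forall i, [/\ S (v i), coprimez (w i).1 (w i).2 & det (v i) (w i) = l],
      forall i y, S y -> det y (w i) <= l,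
      forall i, v i.+1 = ray (v i) (m i) (w i) /\ w i.+1 = ray (w i) (- c i) (v i.+1),
      forall i, 0 < m i /\ 0 < c i
    & forall i j, v i = v j -> w i = w j /\ forall k, v (i + k)%N = v (j + k)%N].
Proof.
move=> h; have [v0 Sv0] := reflexive_ex h.
have l0 := reflexive_gt0 h.
(* The next edge is chosen once for each vertex, so the boundary repeats as soon as a vertex
   does. *)
have /choice[f fP] : forall v, exists f : vec * int, S v ->
    [/\ S (ray v f.2 f.1), 0 < f.2, coprimez f.1.1 f.1.2,
      det v f.1 = l & forall y, S y -> det y f.1 <= l].
  move=> v; have [Sv|nSv] := pselect (S v).
    by have [w [m H]] := reflexive_edge h Sv; exists (w, m).
  by exists ((0, 0), 0).
pose nx v := ray v (f v).2 (f v).1; pose v i := iter i nx v0.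
have Sv i : S (v i) by elim: i => [//|i /fP[]].
pose w i := (f (v i)).1; pose m i := (f (v i)).2.
have vS i : v i.+1 = ray (v i) (m i) (w i) by [].
have wP i : det (v i) (w i) = l by have [] := fP _ (Sv i).
have mP i : 0 < m i by have [] := fP _ (Sv i).
have wle i y : S y -> det y (w i) <= l by have [_ _ _ _] := fP _ (Sv i); apply.
have wco i : coprimez (w i).1 (w i).2 by have [] := fP _ (Sv i).
have per i j : v i = v j -> w i = w j /\ forall k, v (i + k)%N = v (j + k)%N.
  move=> e; split; first by rewrite /w e.
  by move=> k; rewrite /v [(i + k)%N]addnC [(j + k)%N]addnC !iterD -!/(v _) e.
clearbody w m; clearbody v.
have /choice[c cP] : forall i, exists c, w i.+1 = ray (w i) (- c) (v i.+1).
  move=> i.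
  have e : det (v i.+1) (ray (w i) (-1) (w i.+1)) = 0.
    by rewrite det_rayr wP vS det_rayl wP det_self; ring.
  have [t [/= e1 e2]] := coprime_multiple (reflexive_coprime h (Sv i.+1)) e.
  by exists t; rewrite [LHS]surjective_pairing /ray; congr pair; lia.
exists v, w, m, c; split=> //.
- move=> i; split=> //.
  have mi := mP i; have mi' := mP i.+1.
  have d1 : det (v i) (v i.+1) = m i * l by rewrite vS det_rayr det_self wP add0r.
  have d2 : det (v i.+1) (v i.+2) = m i.+1 * l.
    by rewrite [v i.+2]vS det_rayr det_self wP add0r.
  have := wle i.+1 _ (Sv i); rewrite cP det_rayr wP d1 => le.
  have [c0|c0] : 0 < c i \/ c i = 0 by nia.
    by [].
  have [/(congr1 (det (v i))) | /(congr1 (det^~ (v i.+2)))] :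
      v i.+1 = v i \/ v i.+1 = v i.+2.
  + apply: (reflexive_strict h (a := m i.+1) (b := m i) (d := m i + m i.+1)
      (Sv _) (Sv _) (Sv _)); try lia.
    * by rewrite [v i.+2]vS cP c0 [in RHS]vS vS /=; ring.
    * by rewrite [v i.+2]vS cP c0 [in RHS]vS vS /=; ring.
  + by rewrite d1 det_self; nia.
  + by rewrite d2 det_self; nia.
Qed.

Lemma comb_ray v w p q t : comb v w (ray p t q) = ray (comb v w p) t (comb v w q).
Proof. by rewrite /comb /ray /=; congr pair; ring. Qed.

Lemma comb_comb v w p q x :
  comb (comb v w p) (comb v w q) x = comb v w (comb p q x).
Proof. by rewrite /comb /ray /=; congr pair; ring. Qed.

Lemma comb_opp v w p : comb v w (opp p) = opp (comb v w p).
Proof. by rewrite /comb /ray /opp /=; congr pair; ring. Qed.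

Lemma det_combl v w p : det (comb v w p) w = p.1 * det v w.
Proof. by rewrite /det /=; ring. Qed.

Lemma det_combr v w p : det v (comb v w p) = p.2 * det v w.
Proof. by rewrite /det /=; ring. Qed.

Lemma comb_inj v w : det v w != 0 -> injective (comb v w).
Proof.
move=> d0 p q e; rewrite [p]surjective_pairing [q]surjective_pairing.
by congr pair; apply: (mulIf d0); rewrite -?det_combl -?det_combr e.
Qed.

Lemma reflexive_model l r S : reflexive_set l r S ->
  exists C v w, [/\ C \in models, `|det v w| = l,
    [/\ coprimez v.1 v.2, coprimez w.1 w.2
      & coprimez (v.1 + w.1) (v.2 + w.2)]
    & forall x, S x <-> x \in map (comb v w) C].
Proof.
move=> h; have l0 := reflexive_gt0 h.
have [v [w [m [c [vP wle eP pos per]]]]] := reflexive_boundary h.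
have Sv i : S (v i) by have [] := vP i.
have vw i : det (v i) (w i) = l by have [] := vP i.
have vS i : v i.+1 = ray (v i) (m i) (w i) by have [] := eP i.
have d1 i : det (v i) (v i.+1) = m i * l by rewrite vS det_rayr det_self vw add0r.
pose co := comb (v 0%N) (w 0%N).
have co_inj : injective co by apply: comb_inj; rewrite vw; lia.
(* The coordinates in [v 0], [w 0] stay integral, although this basis has determinant [l], because
   the recursion has integer coefficients. *)
pose VW := fix VW i := if i is i'.+1 then
  let v' := ray (VW i').1 (m i') (VW i').2 in (v', ray (VW i').2 (- c i') v')
  else (((1, 0), (0, 1)) : vec * vec).
pose V i := (VW i).1; pose W i := (VW i).2.
have coVW i : co (V i) = v i /\ co (W i) = w i.
  elim: i => [|i [IHv IHw]].
    rewrite /co /comb /ray /=; split; rewrite [RHS]surjective_pairing; congr pair; ring.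
  have e : co (V i.+1) = v i.+1 by rewrite vS -IHv -IHw -comb_ray.
  split=> //; have [_ ->] := eP i; rewrite -e -IHw -comb_ray //.
have coV i : co (V i) = v i by have [] := coVW i.
have coW i : co (W i) = w i by have [] := coVW i.
have detVW i j : det (v i) (w j) = det (V i) (W j) * l.
  by rewrite -coV -coW det_comb vw.
have turn i : 0 < det (v i) (v i.+1) by rewrite d1; have [mi _] := pos i; nia.
(* Of three vertices on one line the middle one violates strictness; the cases on [t] say which one
   is in the middle. *)
have between i t : v 0%N = ray (v i) t (w i) -> v 0%N = v i \/ v 0%N = v i.+1.
  move=> e; have [mi _] := pos i; have ne : v i <> v i.+1.
    by move=> E; have := turn i; rewrite -E det_self.
  have e1 : (v 0%N).1 = (v i).1 + t * (w i).1 by rewrite e.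
  have e2 : (v 0%N).2 = (v i).2 + t * (w i).2 by rewrite e.
  have f1 : (v i.+1).1 = (v i).1 + m i * (w i).1 by rewrite vS.
  have f2 : (v i.+1).2 = (v i).2 + m i * (w i).2 by rewrite vS.
  have [t0|tm|tt] : [\/ t < 0, m i < t | 0 <= t <= m i].
  - have [?|?] := ltP t 0; first exact: Or31.
    by have [?|?] := ltP (m i) t; [apply: Or32|apply: Or33; lia].
  - suff [/esym|//] : v i = v 0%N \/ v i = v i.+1; first by left.
    by apply: (reflexive_strict h (a := m i) (b := - t) (d := m i - t)
      (Sv _) (Sv _) (Sv _)); first [lia | rewrite e1 f1; ring | rewrite e2 f2; ring].
  - suff [/esym//|/esym] : v i.+1 = v i \/ v i.+1 = v 0%N; first by right.
    by apply: (reflexive_strict h (a := t - m i) (b := m i) (d := t)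
      (Sv _) (Sv _) (Sv _)); first [lia | rewrite e1 f1; ring | rewrite e2 f2; ring].
  - by apply: (reflexive_strict h (a := m i - t) (b := t) (d := m i)
      (Sv _) (Sv _) (Sv _)); first [lia | rewrite e1 f1; ring | rewrite e2 f2; ring].
(* The finite list holds the coordinates by Cramer's rule; the divisions by [l] are exact at the
   vertices [v i]. *)
have wk : walk V W m c
    [seq ((det x (w 0%N) %/ l)%Z, (det (v 0%N) x %/ l)%Z) | x <- r].
  split=> //.
  - by move=> i; have [] := pos i.
  - by move=> i; have [] := pos i.
  - move=> i; apply/mapP; exists (v i); first exact: (reflexive_fin h).
    rewrite -coV det_combl det_combr vw [LHS]surjective_pairing.
    by rewrite !mulzK //; lia.
  - by move=> i j; have := wle i _ (Sv j); rewrite detVW; nia.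
  - move=> i e; have [_ cw _] := vP i.
    have e0 : det (w i) (ray (v 0%N) (-1) (v i)) = 0.
      have a1 : det (w i) (v 0%N) = - det (v 0%N) (w i) by rewrite /det; ring.
      have a2 : det (w i) (v i) = - det (v i) (w i) by rewrite /det; ring.
      by rewrite det_rayr a1 a2 vw detVW e; ring.
    have [t [/= e1 e2]] := coprime_multiple cw e0.
    have E : v 0%N = ray (v i) t (w i).
      by rewrite [LHS]surjective_pairing /ray; congr pair; lia.
    by have [e'|e'] := between i t E; [left|right]; apply: co_inj; rewrite !coV.
  - move=> n e; apply: co_inj; rewrite !coW; apply: (proj1 (per n 0%N _)).
    by rewrite -!coV e.
have [k [k0 Vk]] := walk_has_model wk.
move=> /hasP[C CM /hasP[p pV /hasP[q qW /and3P[pq /eqP dpq pe]]]].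
have goodV x : x \in rev (mkseq V k) -> coprimez (co x).1 (co x).2.
  by rewrite mem_rev => /mapP[i _ ->]; rewrite coV; apply: (reflexive_coprime h).
have goodW x : x \in rev (mkseq W k) -> coprimez (co x).1 (co x).2.
  by rewrite mem_rev => /mapP[i _ ->]; rewrite coW; have [] := vP i.
have goodD x : x \in rev (mkseq W k) ++ map opp (rev (mkseq W k)) ->
    coprimez (co x).1 (co x).2.
  rewrite mem_cat => /orP[/goodW//|/mapP[y /goodW yP ->]].
  by rewrite /co comb_opp /= coprimezN coprimeNz.
exists C, (co p), (co q); split => //.
- by rewrite det_comb vw normrM dpq mul1r gtr0_norm.
- split; [exact: goodV|exact: goodD|].
  have -> : (co p).1 + (co q).1 = (co (ray p 1 q)).1.
    by rewrite /co comb_ray /ray !mul1r.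
  have -> : (co p).2 + (co q).2 = (co (ray p 1 q)).2.
    by rewrite /co comb_ray /ray !mul1r.
  by move: pq; rewrite mem_cat => /orP[/goodV|/goodD].
- move=> x; have cc : comb (co p) (co q) =1 co \o comb p q by move=> y; exact: comb_comb.
  rewrite (eq_map cc) map_comp -(perm_mem (perm_map co pe)); split; last first.
    by move=> /mapP[y]; rewrite mem_rev => /mapP[i _ ->] ->; rewrite coV.
  (* A vertex [x] lies in the cone of some edge and not beyond that edge, hence in the triangle with
     the origin; strictness makes it an end of the edge. *)
  move=> Sx; have x0 : x != (0, 0).
    by apply/eqP => e; have := reflexive_coprime h Sx; rewrite e.
  have [i [h1 h2]] := turning_cover (fun j => reflexive_fin h (Sv j)) turn x0.
  have [j ->] : exists j, x = v j.
    have mi := (pos i).1.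
    have le : m i * det x (w i) <= m i * l by have := wle i _ Sx; nia.
    have e : det x (v i.+1) + det (v i) x = m i * det x (w i).
      rewrite vS det_rayr.
      have -> : det x (v i) = - det (v i) x by rewrite /det; ring.
      ring.
    have e' : det x (v i.+1) = - det (v i.+1) x by rewrite /det; ring.
    have [->|->] : x = v i \/ x = v i.+1; [|by exists i|by exists i.+1].
    apply: (reflexive_strict h (a := det x (v i.+1)) (b := det (v i) x)
      (d := det (v i) (v i.+1)) Sx (Sv _) (Sv _)) => //.
    + by rewrite e'; lia.
    + by rewrite e d1.
    + by rewrite /det; ring.
    + by rewrite /det; ring.
  have vmod : v j = v (j %% k)%N.
    have e0 : v k = v 0%N by rewrite -!coV Vk.
    have step t : v (t + k)%N = v t by rewrite addnC (per _ _ e0).2.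
    rewrite {1}(divn_eq j k) addnC; elim: (j %/ k)%N => [|n IH]; first by rewrite addn0.
    by rewrite mulSn [(k + _)%N]addnC addnA step.
  rewrite vmod -coV map_f // mem_rev; apply/mapP; exists (j %% k)%N => //.
  by rewrite mem_iota add0n ltn_mod.
Qed.

(** * Vertices and edges of convex hulls *)

Definition lin (p q : rat) (x : 'cV[rat]_2) : rat := p * x 0 0 + q * x 1 0.

Definition area (x y : 'cV[rat]_2) : rat := x 0 0 * y 1 0 - x 1 0 * y 0 0.

Definition row2 (p q : rat) : 'rV[rat]_2 := \row_j (if j == 0 then p else q).

Lemma pairingE u x : pairing u x = lin (u 0 0) (u 0 1) x.
Proof.
rewrite /pairing /lin mxE !big_ord_recl big_ord0 addr0; congr (_ * _ + u _ _ * x _ _).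
  exact: val_inj.
exact: val_inj.
Qed.

Lemma pairing_row2 p q x : pairing (row2 p q) x = lin p q x.
Proof. by rewrite pairingE !mxE. Qed.

Lemma cV2_eq (R : Type) (x y : 'cV[R]_2) : x 0 0 = y 0 0 -> x 1 0 = y 1 0 -> x = y.
Proof.
move=> h0 h1; apply/matrixP => i j; rewrite (ord1 j).
by case: i => [[|[|//]] Hi]; [move: h0|move: h1]; congr (x _ _ = y _ _); apply: val_inj.
Qed.

Lemma lin0 p q : lin p q 0 = 0.
Proof. by rewrite /lin !mxE !mulr0 addr0. Qed.

Lemma lin_conv p q (x y : 'cV[rat]_2) t :
  lin p q (t *: x + (1 - t) *: y) = t * lin p q x + (1 - t) * lin p q y.
Proof. by rewrite /lin !mxE; ring. Qed.

Lemma convex_setP (A : set 'cV[rat]_2) :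
  (forall x y (t : rat), A x -> A y -> 0 < t -> t < 1 -> A (t *: x + (1 - t) *: y)) ->
  convex_set A.
Proof.
move=> h; apply/convex_setW => x y; rewrite !inE => Ax Ay k k0 k1.
by rewrite in_setE; exact: (h x y k%:num).
Qed.

Lemma hull_sub (S A : set 'cV[rat]_2) :
  S `<=` A ->
  (forall x y (t : rat), A x -> A y -> 0 < t -> t < 1 -> A (t *: x + (1 - t) *: y)) ->
  convex_hull S `<=` A.
Proof. by move=> SA /convex_setP cA; apply: smallest_sub. Qed.

Lemma sub_hull (S : set 'cV[rat]_2) : S `<=` convex_hull S.
Proof. exact: sub_gen_smallest. Qed.

Lemma hull_le (S : set 'cV[rat]_2) p q M :
  (forall s, S s -> lin p q s <= M) -> forall x, convex_hull S x -> lin p q x <= M.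
Proof.
move=> h; apply: (@hull_sub _ [set x | lin p q x <= M]) => // x y t /= hx hy t0 t1.
by rewrite lin_conv; nra.
Qed.

(** The point [v] together with the open half-plane below it is convex and contains [S]. *)
Lemma hull_vertex (S : set 'cV[rat]_2) p q v : S v ->
  (forall s, S s -> s <> v -> lin p q s < lin p q v) -> vertex (convex_hull S) v.
Proof.
move=> Sv h.
have hull x : convex_hull S x -> x = v \/ lin p q x < lin p q v.
  apply: (@hull_sub _ [set x | x = v \/ lin p q x < lin p q v]).
    move=> s Ss; have [->|ne] := eqVneq s v; first by left.
    by right; apply: h => //; apply/eqP.
  move=> {}x y t /= [->|hx] [->|hy] t0 t1; rewrite ?lin_conv.
  - by left; rewrite -scalerDl addrC subrK scale1r.
  - by right; nra.
  - by right; nra.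
  - by right; nra.
exists (row2 p q); apply/seteqP; split=> x /=.
  move=> ->; split; first exact: sub_hull.
  by move=> y /hull; rewrite !pairing_row2 => -[->//|/ltW].
move=> [/hull[//|ltx] mx]; have := mx v (sub_hull Sv).
by rewrite !pairing_row2 leNgt ltx.
Qed.

(** Otherwise [S] lies in the open half-plane strictly below [v], and so does its hull, which
    contains [v]. *)
Lemma vertex_generator (S : set 'cV[rat]_2) v : vertex (convex_hull S) v -> S v.
Proof.
move=> [u Hu]; have [hv mv] : [set x | convex_hull S x /\
    forall y, convex_hull S y -> pairing u y <= pairing u x] v by rewrite -Hu.
apply: contrapT => nSv; suff : pairing u v < pairing u v by rewrite ltxx.
rewrite {1}pairingE; move: v hv {mv Hu nSv} (mv) (Hu) (nSv) => v hv mv Hu nSv.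
apply: (@hull_sub S [set x | lin (u 0 0) (u 0 1) x < pairing u v]) hv => [s Ss|x y t] /=.
  rewrite -pairingE lt_neqAle mv ?andbT; last exact: sub_hull.
  apply/eqP => e; apply: nSv; suff -> : v = s by [].
  suff : [set v] s by [].
  by rewrite Hu; split; [exact: sub_hull|rewrite e].
by rewrite lin_conv => hx hy t0 t1; nra.
Qed.

Lemma seq_argmax (T : eqType) (f : T -> rat) (r : seq T) x : x \in r ->
  exists2 y, y \in r & forall z, z \in r -> f z <= f y.
Proof.
elim: r x => [//|a r IH] x _; case: r IH => [|b r] IH.
  by exists a; rewrite ?mem_head // => z; rewrite inE => /eqP->.
have [y yr hy] := IH b (mem_head _ _).
have [le|lt] := leP (f a) (f y).
  exists y; first by rewrite inE yr orbT.
  by move=> z; rewrite inE => /orP[/eqP->|/hy].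
exists a; first exact: mem_head.
by move=> z; rewrite inE => /orP[/eqP->//|/hy h]; apply: le_trans h (ltW lt).
Qed.

(** The lexicographic maximum for two independent functionals is the unique maximum of [N] times the
    first plus the second, once [N] is large. *)
Lemma lexmax_vertex (r : seq 'cV[rat]_2) x p q p' q' :
  x \in r -> p * q' - q * p' != 0 ->
  exists v, [/\ v \in r, vertex (convex_hull [set` r]) v,
    forall s, s \in r -> lin p q s <= lin p q v
  & forall s, s \in r -> lin p q s = lin p q v -> lin p' q' s <= lin p' q' v].
Proof.
move=> xr D0; have [m mr hm] := seq_argmax (lin p q) xr.
have m' : m \in [seq s <- r | lin p q s == lin p q m] by rewrite mem_filter eqxx.
have [v] := seq_argmax (lin p' q') m'; rewrite mem_filter => /andP[/eqP ev vr] hv.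
have hv' s : s \in r -> lin p q s = lin p q v -> lin p' q' s <= lin p' q' v.
  by move=> sr es; apply: hv; rewrite mem_filter sr -ev es eqxx.
exists v; split=> //; last by move=> s /hm; rewrite ev.
have [N hN] : exists N, forall N' s, N <= N' -> s \in r -> s <> v ->
    N' * lin p q s + lin p' q' s < N' * lin p q v + lin p' q' v.
  have sub : {subset r <= r} by [].
  elim: {-2}r sub => [|s t IH] sub; first by exists 0.
  have [N hN] := IH (fun z zt => sub z (mem_behead (s := s :: t) zt)).
  have sr : s \in r by apply: sub; exact: mem_head.
  have hs := hm s sr; rewrite -ev in hs.
  pose u := lin p q v - lin p q s; pose h := lin p' q' s - lin p' q' v.
  exists (Num.max N (h / u + 1)) => N' z; rewrite ge_max => /andP[NN' h1].
  rewrite inE => /orP[/eqP-> ne|zt ne]; last exact: hN.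
  have [es|ns] := eqVneq (lin p q s) (lin p q v).
    have h2 := hv' s sr es.
    rewrite es ltrD2l lt_neqAle h2 andbT; apply/eqP => es'; apply: ne.
    have k0 : (p * q' - q * p') * (s 0 0 - v 0 0) = 0.
      transitivity (q' * (lin p q s - lin p q v) - q * (lin p' q' s - lin p' q' v)).
        by rewrite /lin; ring.
      by rewrite es es' !subrr !mulr0 subrr.
    have k1 : (p * q' - q * p') * (s 1 0 - v 1 0) = 0.
      transitivity (p * (lin p' q' s - lin p' q' v) - p' * (lin p q s - lin p q v)).
        by rewrite /lin; ring.
      by rewrite es es' !subrr !mulr0 subrr.
    by apply: cV2_eq; apply/eqP; rewrite -subr_eq0 -(mulrI_eq0 _ (mulfI D0)) ?k0 ?k1.
  have u0 : 0 < u by rewrite subr_gt0 lt_neqAle ns hs.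
  have : h < N' * u.
    by rewrite -ltr_pdivrMr //; apply: lt_le_trans h1; rewrite ltrDl.
  by rewrite /h /u; nra.
apply: (@hull_vertex _ (N * p + p') (N * q + q')) => //= s sr ne.
have linN y : lin (N * p + p') (N * q + q') y = N * lin p q y + lin p' q' y.
  by rewrite /lin; ring.
by rewrite !linN hN.
Qed.

(** The witness is a small multiple of the signs of [p] and [q], which lies in a ball of the maximum
    norm. *)
Lemma interior_lin (P : set 'cV[rat]_2) p q :
  interior (P : set 'cV[rat^o]_2) 0 -> (p != 0) || (q != 0) ->
  exists2 x, P x & 0 < lin p q x.
Proof.
move=> /nbhs_ballP[e /= e0 eP] pq.
pose f (t : rat) : rat := (e / 2) * Num.sg t.
have f_lt t : `|f t| < e.
  rewrite normrM (gtr0_norm (divr_gt0 e0 _)) // normr_sg.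
  by case: (t != 0); rewrite ?mulr1 ?mulr0 // ltr_pdivrMr // ltr_pMr // ltr1n.
have h2 : 0 < e / 2 by apply: divr_gt0.
exists (\col_i f (if i == 0 then p else q)); last first.
  have sgE t : t * f t = e / 2 * `|t| by rewrite /f mulrCA [t * _]mulrC -normrEsg.
  rewrite /lin !mxE /= !sgE -mulrDr; apply: mulr_gt0 => //.
  by case/orP: pq; rewrite -normr_gt0 => h; [apply: ltr_wpDr|apply: ltr_wpDl].
apply: eP; split => // i j; rewrite !mxE /ball /= sub0r normrN; exact: f_lt.
Qed.

(** The exposing functional exceeds its value 0 at the origin, unless [v] is the origin; but then
    [interior_lin] finds a point of the hull with a larger value. *)
Lemma vertex_lin (S : set 'cV[rat]_2) v :
  interior (convex_hull S : set 'cV[rat^o]_2) 0 -> vertex (convex_hull S) v ->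
  exists p q, 0 < lin p q v /\
    forall y, convex_hull S y -> y <> v -> lin p q y < lin p q v.
Proof.
move=> i0 [u Hu]; have P0 := interior_subset i0.
pose p := u 0 0; pose q := u 0 1.
have [hv mv] : [set x | convex_hull S x /\
    forall y, convex_hull S y -> pairing u y <= pairing u x] v by rewrite -Hu.
have lt y : convex_hull S y -> y <> v -> lin p q y < lin p q v.
  move=> hy ne; rewrite lt_neqAle -!pairingE mv // andbT; apply/eqP => e.
  by apply: ne; suff : [set v] y by []; rewrite Hu; split=> //; rewrite e.
exists p, q; split=> //.
have [v0|/eqP v0] := eqVneq v 0; last by rewrite -(lin0 p q); apply: lt => // e; apply: v0.
have [s1 hs1 s1p] := interior_lin (p := 1) (q := 0) i0 isT.
have nz s p' q' : 0 < lin p' q' s -> s <> v by move=> h e; rewrite e v0 lin0 ltxx in h.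
have pq : (p != 0) || (q != 0).
  rewrite -negb_and; apply/negP => /andP[/eqP pz /eqP qz].
  by have := lt s1 hs1 (nz _ _ _ s1p); rewrite pz qz /lin !mul0r ltxx.
have [s2 hs2 s2p] := interior_lin i0 pq.
by have := lt s2 hs2 (nz _ _ _ s2p); rewrite v0 lin0 ltNge (ltW s2p).
Qed.

Lemma areaE x y : area x y = lin (- x 1 0) (x 0 0) y.
Proof. by rewrite /area /lin; ring. Qed.

(* The edge leaving [v] has the steepest slope as seen from [v], measured against a functional
   [lin a b] exposing [v]; its far end is the lexicographic maximum along this edge. *)
Lemma next_vertex (r : seq 'cV[rat]_2) v : let P := convex_hull [set` r] in
  interior (P : set 'cV[rat^o]_2) 0 -> vertex P v ->
  exists v' p q, [/\ vertex P v', lin p q v' = lin p q v,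
    forall y, P y -> lin p q y <= lin p q v, 0 < lin p q v & 0 < area v v'].
Proof.
move=> P i0 hv; have vr : v \in r := vertex_generator hv.
have [a [b [gv glt]]] := vertex_lin i0 hv.
have rP s : s \in r -> P s by move=> sr; apply: sub_hull.
have nz : (- v 1 0 != 0) || (v 0 0 != 0).
  rewrite -negb_and oppr_eq0; apply/negP => /andP[/eqP v1 /eqP v0].
  by rewrite /lin v0 v1 !mulr0 addr0 ltxx in gv.
have [s0 s0r s0p] : exists2 s, s \in r & 0 < area v s.
  have [x Px xp] := interior_lin i0 nz.
  apply: contrapT => no; suff : area v x <= 0 by rewrite areaE leNgt xp.
  rewrite areaE; apply: hull_le Px => s sr; rewrite -areaE leNgt; apply/negP => h.
  by apply: no; exists s.
have ne s : 0 < area v s -> s <> v.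
  by move=> h e; move: h; rewrite e /area [v 0 0 * _]mulrC subrr ltxx.
pose k s := area v s / (lin a b v - lin a b s).
have den s : s \in r -> s <> v -> 0 < lin a b v - lin a b s.
  by move=> sr nes; rewrite subr_gt0; apply: glt => //; apply: rP.
have [s1] : exists2 y, y \in [seq s <- r | s != v] &
    forall z, z \in [seq s <- r | s != v] -> k z <= k y.
  by apply: (@seq_argmax _ k _ s0); rewrite mem_filter s0r andbT; apply/eqP/ne.
rewrite mem_filter => /andP[/eqP s1v s1r] kmax.
pose K := k s1.
have K0 : 0 < K.
  apply: lt_le_trans (kmax s0 _); last by rewrite mem_filter s0r andbT; apply/eqP/ne.
  by apply: divr_gt0 => //; apply: den => //; apply: ne.
(* This is [area v] plus [K] times [lin a b]: the maximal slope [K] makes it equal at [v] and [s1]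
   and no larger at the other generators. *)
pose p := - v 1 0 + K * a; pose q := v 0 0 + K * b.
have linE y : lin p q y = area v y + K * lin a b y by rewrite /lin /area /p /q; ring.
have av : area v v = 0 by rewrite /area; ring.
have linv : lin p q v = K * lin a b v by rewrite linE av add0r.
have kE s : s \in r -> s <> v -> area v s = k s * (lin a b v - lin a b s).
  by move=> sr nes; rewrite /k mulfVK // gt_eqF // den.
have le s : s \in r -> lin p q s <= lin p q v.
  move=> sr; have [->//|/eqP nes] := eqVneq s v.
  rewrite linv linE (kE s) //.
  have ks : k s <= K by apply: kmax; rewrite mem_filter sr andbT; apply/eqP.
  have := den s sr nes; nra.
have s1E : lin p q s1 = lin p q v by rewrite linv linE (kE s1) // -/K; ring.
have D : p * v 0 0 - q * (- v 1 0) != 0.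
  suff -> : p * v 0 0 - q * (- v 1 0) = K * lin a b v by rewrite gt_eqF // mulr_gt0.
  by rewrite /p /q /lin; ring.
(* The second functional is [area v], so [v'] is the counterclockwise end of the edge. *)
have [v' [v'r v'P m1 m2]] := lexmax_vertex s1r D.
have v'E : lin p q v' = lin p q v.
  by apply/eqP; rewrite eq_le le //= -s1E m1.
exists v', p, q; split=> //; last 2 first.
- by rewrite linv mulr_gt0.
- have := m2 s1 s1r; rewrite s1E v'E -!areaE => /(_ erefl); apply: lt_le_trans.
  by rewrite (kE s1) // mulr_gt0 // den.
by apply: hull_le.
Qed.

(** * Primitive vectors and integral coordinates *)

Lemma primitive_unit m n (x : 'M[int]_(m, n)) (d : int) :
  primitive x -> 0 < d -> (forall i j, (d %| x i j)%Z) -> d = 1.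
Proof.
move=> [x0 px] d0 dx.
have dq : (d%:~R : rat) != 0 by rewrite intr_eq0 gt_eqF.
have xE i j : x i j = (x i j %/ d)%Z * d by rewrite divzK.
(* The quotient of [x] by [d] is a lattice point on the segment from 0 to [x]. *)
have [] := px (\matrix_(i, j) (x i j %/ d)%Z) (d%:~R)^-1.
- rewrite invr_ge0 ler0z (ltW d0) /= invf_le1 ?ltr0z // ler1z; lia.
- apply/matrixP => i j; rewrite !mxE [in RHS]xE intrM mulrC mulfK //.
- move=> y0; case/eqP: x0; apply/matrixP => i j; rewrite xE !mxE.
  by have := congr1 (fun M : 'M_(m, n) => M i j) y0; rewrite !mxE => ->; rewrite mul0r.
- move=> yx; have [i [j xij]] : exists i j, x i j != 0.
    apply: contrapT => no; case/eqP: x0; apply/matrixP => i j; rewrite mxE.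
    by apply/eqP; apply: contrapT => /negP h; apply: no; exists i, j.
  have := congr1 (fun M : 'M_(m, n) => M i j) yx; rewrite !mxE => e.
  by have := xE i j; rewrite e; move: xij; nia.
Qed.

Lemma primitive_col (x : 'cV[int]_2) : primitive x -> coprimez (x 0 0) (x 1 0).
Proof.
move=> px; have [x0 _] := px; apply/eqP/(primitive_unit px).
  rewrite lt0r gcdz_eq0 andbT; apply: contra x0 => /andP[/eqP e0 /eqP e1].
  by apply/eqP/cV2_eq; rewrite mxE.
move=> i j; rewrite (ord1 j); case: i => [[|[|//]] Hi].
  by rewrite (_ : Ordinal Hi = 0) ?dvdz_gcdl //; apply: val_inj.
by rewrite (_ : Ordinal Hi = 1) ?dvdz_gcdr //; apply: val_inj.
Qed.

Lemma primitive_tr m n (x : 'M[int]_(m, n)) : primitive x -> primitive x^T.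
Proof.
move=> [x0 px]; split=> [|y t t01 e]; first by rewrite trmx_eq0.
have [|y0|yx] := px y^T t t01.
- apply/matrixP => i j; have := congr1 (fun M : 'M_(n, m) => M j i) e.
  by rewrite !mxE.
- by left; rewrite -[y]trmxK y0 trmx0.
- by right; rewrite -[y]trmxK yx.
Qed.

Lemma primitive_row (u : 'rV[int]_2) : primitive u -> coprimez (u 0 0) (u 0 1).
Proof. by move=> /primitive_tr/primitive_col; rewrite !mxE. Qed.

Definition col2 (x : vec) : 'cV[int]_2 := \col_i (if i == 0 then x.1 else x.2).

Lemma col2K (x : 'cV[int]_2) : col2 (x 0 0, x 1 0) = x.
Proof. by apply: cV2_eq; rewrite mxE. Qed.

Lemma toQ_col2 x : (toQ (col2 x) 0 0 = x.1%:~R) * (toQ (col2 x) 1 0 = x.2%:~R).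
Proof. by rewrite !mxE. Qed.

(** Cramer's rule for [x] in terms of [v] and [v'], followed by a functional constant on the
    edge. *)
Lemma functional_edge (v v' x : 'cV[rat]_2) p q :
  lin p q v' = lin p q v ->
  area v v' * lin p q x = lin p q v * (area x v' + area v x).
Proof.
move=> e; transitivity (lin p q v * area x v' + lin p q v' * area v x).
  by rewrite /area /lin; ring.
by rewrite e -mulrDr.
Qed.

Lemma edge_facet (S : set 'cV[rat]_2) v v' p q : let P := convex_hull S in
  P v -> P v' -> lin p q v' = lin p q v -> 0 < lin p q v -> 0 < area v v' ->
  (forall y, P y -> lin p q y <= lin p q v) ->
  facet P [set x | P x /\ lin p q x = lin p q v].
Proof.
move=> P Pv Pv' v'E v0 D0 le; split.
  exists (row2 p q); apply/seteqP; split=> x /= [Px h]; split=> //.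
    by move=> y /le; rewrite !pairing_row2 h.
  by apply/eqP; rewrite eq_le le //=; have := h v Pv; rewrite !pairing_row2.
have neq : v' - v != 0.
  by rewrite subr_eq0; apply/eqP => e; move: D0; rewrite e /area [v 0 0 * _]mulrC subrr ltxx.
exists v, <[v' - v]>%VS; split=> //=.
- by rewrite dim_vline neq.
(* On the line of the edge the Cramer coefficients of [v] and [v'] add up to 1, and the one of [v']
   is the parameter along the edge. *)
- move=> x [Px xE]; apply/vlineP; exists (area v x / area v v').
  have s : area x v' + area v x = area v v'.
    by apply: (mulfI (lt0r_neq0 v0)); rewrite -(functional_edge _ v'E) xE mulrC.
  have Dn := lt0r_neq0 D0.
  apply: cV2_eq; rewrite !mxE; apply: (mulIf Dn); rewrite mulrAC divfK //.
    transitivity (x 0 0 * area v v' - v 0 0 * area v v'); first by ring.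
    by rewrite -{2}s /area; ring.
  transitivity (x 1 0 * area v v' - v 1 0 * area v v'); first by ring.
  by rewrite -{2}s /area; ring.
- move=> U hU; rewrite -memvE; exact: hU.
Qed.

Lemma lin_toQ (p q : int) (x : vec) :
  lin p%:~R q%:~R (toQ (col2 x)) = (p * x.1 + q * x.2)%:~R.
Proof. by rewrite /lin !toQ_col2 intrD !intrM. Qed.

Lemma pairing_toQ (u : 'rV[int]_2) (x : vec) :
  pairing (toQ u) (toQ (col2 x)) = (u 0 0 * x.1 + u 0 1 * x.2)%:~R.
Proof. by rewrite pairingE -lin_toQ !mxE. Qed.

Lemma area_toQ x y : area (toQ (col2 x)) (toQ (col2 y)) = (det x y)%:~R.
Proof. by rewrite /area !toQ_col2 /det intrB !intrM. Qed.

Lemma toQ_inj m n : injective (@toQ m n).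
Proof.
move=> x y e; apply/matrixP => i j; apply/eqP; rewrite -(eqr_int rat).
by have := congr1 (fun M : 'M_(m, n) => M i j) e; rewrite !mxE => ->.
Qed.

Lemma col2_inj : injective col2.
Proof.
move=> [a b] [c d] e; have := (congr1 (fun M : 'cV_2 => M 0 0) e).
by have := (congr1 (fun M : 'cV_2 => M 1 0) e); rewrite !mxE /= => -> ->.
Qed.

(** Equality would force [a = b = 0] and then [d * x = 0]. Applied to the values of a functional
    exposing a vertex, this yields [reflexive_strict]. *)
Lemma strict_mean (R : realFieldType) (a b d x y z : R) : y < x -> z < x -> 0 < x ->
  0 <= a -> 0 <= b -> 0 < d -> a + b <= d -> a * y + b * z < d * x.
Proof.
move=> yx zx x0 a0 b0 d0 abd.
have ay : a * y <= a * x by rewrite ler_wpM2l // ltW.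
have bz : b * z <= b * x by rewrite ler_wpM2l // ltW.
have abx : a * x + b * x <= d * x by rewrite -mulrDl ler_wpM2r // ltW.
rewrite lt_neqAle (le_trans (lerD ay bz) abx) andbT; apply/eqP => e.
have az0 : a * (x - y) = 0 by lra.
have bz0 : b * (x - z) = 0 by lra.
have dx0 : d * x = 0.
  move/eqP: az0; rewrite mulf_eq0 subr_eq0 (gt_eqF yx) orbF => /eqP a_eq0.
  move/eqP: bz0; rewrite mulf_eq0 subr_eq0 (gt_eqF zx) orbF => /eqP b_eq0.
  by rewrite -e a_eq0 b_eq0 !mul0r addr0.
by have := mulr_gt0 d0 x0; rewrite dx0 ltxx.
Qed.

Lemma l_reflexive_set l P : (0 < l)%N -> l_reflexive l P ->
  exists r, reflexive_set l%:Z r (fun x => vertex P (toQ (col2 x))).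
Proof.
move=> l0 [[[S /finite_seqP[r Sr] PE] _ lat] i0 prim fac]; rewrite {S}Sr in PE.
subst P; set P := convex_hull _ in lat i0 prim fac *.
have latv v : vertex P v -> exists x, v = toQ (col2 x).
  by move=> /lat[x ->]; exists (x 0 0, x 1 0); rewrite col2K.
have rP s : s \in r -> P s by move=> sr; apply: sub_hull.
have vP v : vertex P v -> P v by move=> /vertex_generator/rP.
(* Generators may be non-integral; numerators give the right coordinates at the vertices, which are
   integral. *)
exists [seq (numq (s 0 0), numq (s 1 0)) | s : 'cV[rat]_2 <- r]; split.
- by rewrite ltz_nat.
- have [x Px xp] := interior_lin (p := 1) (q := 0) i0 isT.
  have [x0 x0r] : exists x0, x0 \in r.
    apply: contrapT => no; suff : lin 1 0 x <= 0 by rewrite leNgt xp.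
    by apply: hull_le Px => s sr; case: no; exists s.
  have [] := @lexmax_vertex r x0 1 0 0 1 x0r isT.
  by move=> v [_ /[dup] /latv[y ->] vy _ _]; exists y.
- move=> v hv; apply/mapP; exists (toQ (col2 v)); first exact: vertex_generator hv.
  by rewrite !toQ_col2 !numq_int -surjective_pairing.
- by move=> v /prim/primitive_col; rewrite !mxE.
- move=> x y z a b d hx hy hz a0 b0 d0 abd e1 e2.
  have [p [q [gx ltx]]] := vertex_lin i0 hx.
  have [->|/eqP xy] := eqVneq x y; first by left.
  have [->|/eqP xz] := eqVneq x z; first by right.
  have ly := ltx _ (vP _ hy) (fun e => xy (esym (col2_inj (toQ_inj e)))).
  have lz := ltx _ (vP _ hz) (fun e => xz (esym (col2_inj (toQ_inj e)))).
  have e : d%:~R * lin p q (toQ (col2 x)) =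
      a%:~R * lin p q (toQ (col2 y)) + b%:~R * lin p q (toQ (col2 z)).
    have f1 : (d%:~R : rat) * x.1%:~R = a%:~R * y.1%:~R + b%:~R * z.1%:~R.
      by rewrite -!intrM e1 intrD !intrM.
    have f2 : (d%:~R : rat) * x.2%:~R = a%:~R * y.2%:~R + b%:~R * z.2%:~R.
      by rewrite -!intrM e2 intrD !intrM.
    rewrite /lin !toQ_col2.
    transitivity (p * (d%:~R * x.1%:~R) + q * (d%:~R * x.2%:~R)); first by ring.
    by rewrite f1 f2; ring.
  have a0' : 0 <= a%:~R :> rat by rewrite ler0z.
  have b0' : 0 <= b%:~R :> rat by rewrite ler0z.
  have d0' : 0 < d%:~R :> rat by rewrite ltr0z.
  have abd' : a%:~R + b%:~R <= d%:~R :> rat by rewrite -intrD ler_int.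
  by have := lt_eqF (strict_mean ly lz gx a0' b0' d0' abd'); rewrite e eqxx.
- move=> v hv; have [v'] := next_vertex i0 hv.
  move=> [p [q [hv' v'E le v0 D0]]].
  have [x' ex'] := latv _ hv'; rewrite {v'}ex' in hv' v'E D0.
  have [u [pu _ uE]] := fac _ (edge_facet (vP _ hv) (vP _ hv') v'E v0 D0 le).
  have uv : pairing (toQ u) (toQ (col2 v)) = l%:R.
    have : [set x | P x /\ lin p q x = lin p q (toQ (col2 v))] (toQ (col2 v)).
      by split=> //; apply: vP.
    by rewrite uE => -[].
  have uv' : pairing (toQ u) (toQ (col2 x')) = l%:R.
    have : [set x | P x /\ lin p q x = lin p q (toQ (col2 v))] (toQ (col2 x')).
      by split=> //; apply: vP.
    by rewrite uE => -[].
  (* The normal turned by a quarter, so that pairing with [u] is [det _ w]. *)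
  pose w : vec := (- u 0 1, u 0 0).
  have wE y : pairing (toQ u) (toQ (col2 y)) = (det y w)%:~R.
    by rewrite pairing_toQ /det /w /=; congr (_%:~R); ring.
  have cw : coprimez w.1 w.2.
    by rewrite /= coprimeNz coprimez_sym; apply: primitive_row.
  have dv : det v w = l%:Z by apply/eqP; rewrite -(eqr_int rat) -wE uv.
  have dx' : det x' w = l%:Z by apply/eqP; rewrite -(eqr_int rat) -wE uv'.
  have [m [m1 m2]] : exists m, ray x' (-1) v = (m * w.1, m * w.2).
    apply: coprime_multiple => //.
    have -> : det w (ray x' (-1) v) = det v w - det x' w by rewrite /det /=; ring.
    by rewrite dv dx' subrr.
  have x'E : x' = ray v m w.
    by rewrite [LHS]surjective_pairing /ray -m1 -m2; congr pair; ring.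
  exists w, m; rewrite -x'E; split=> //.
    move: D0; rewrite area_toQ ltr0z x'E.
    have -> : det v (ray v m w) = m * det v w by rewrite /det /=; ring.
    by rewrite dv pmulr_lgt0 // ltz_nat.
  (* Both [u] and [lin p q] are constant along the edge with positive values, hence proportional by
     [functional_edge], and the edge inequality passes to [u]. *)
  move=> y /vP/le; rewrite -(ler_int rat) -wE => ley.
  rewrite -(ler_pM2l D0) pairingE functional_edge; last by rewrite -!pairingE uv.
  rewrite -pairingE uv; have := functional_edge (toQ (col2 y)) v'E.
  move: ley D0 v0; move: (lin p q _) (lin p q _) (area _ _) (area _ _ + _).
  move=> Y X D s ley D0 X0 e.
  have : s <= D by nra.
  have : (0 : rat) < l%:R by rewrite ltr0n.
  have -> : l%:Z%:~R = l%:R :> rat by [].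
  by move: (l%:R : rat) => L L0 sD; rewrite [leLHS]mulrC ler_pM2r.
Qed.

(** * Counting *)

Lemma isomorphic_trans P P' P'' : isomorphic P P' -> isomorphic P' P'' -> isomorphic P P''.
Proof.
move=> [A [b [uA e]]] [A' [b' [uA' e']]].
exists (A' *m A), (A' *m b + b'); split; first by rewrite unitmx_mul uA'.
rewrite -e' -e image_comp; apply: eq_imagel => x _ /=.
by rewrite mulmxDr addrA mulmxA.
Qed.

(* Turns coordinates in (v, w) into coordinates in (v, z), where w = l z - k v. *)
Definition skew (l k : nat) (c : vec) : vec := (c.1 - k%:Z * c.2, l%:Z * c.2).

(** [C] describes the polygon inside the sublattice, [k] the position of the sublattice in the
    lattice, and [M] a basis of the lattice. *)
Definition has_code (l : nat) (P : set 'cV[rat]_2) (C : seq vec) (k : nat) : Prop :=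
  exists2 M : 'M[int]_2, M \in unitmx &
    lattice_vertices P = [set M *m col2 (skew l k c) | c in [set` C]].

Lemma has_code_isomorphic l P P' C k :
  has_code l P C k -> has_code l P' C k -> isomorphic P P'.
Proof.
move=> [M uM e] [M' uM' e']; exists (M' *m invmx M), 0; split.
  by rewrite unitmx_mul uM' unitmx_inv.
rewrite e e' image_comp; apply: eq_imagel => c _ /=.
by rewrite addr0 mulmxA mulmxKV.
Qed.

Definition mx2 (v z : vec) : 'M[int]_2 :=
  \matrix_(i, j) (if i == 0 then if j == 0 then v.1 else z.1
                  else if j == 0 then v.2 else z.2).

Lemma mx2_col2 v z c : mx2 v z *m col2 c = col2 (comb v z c).
Proof.
by apply: cV2_eq; rewrite !mxE !big_ord_recl big_ord0 !mxE /= addr0 [c.1 * _]mulrC [c.2 * _]mulrC.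
Qed.

Lemma mx2_unit v z : `|det v z| = 1 -> mx2 v z \in unitmx.
Proof.
move=> d1; pose e := det v z.
have ee : e * e = 1 by rewrite -expr2 -real_normK ?num_real // d1.
suff /mulmx1_unit[] : mx2 v z *m mx2 (e * z.2, - (e * v.2)) (- (e * z.1), e * v.1) = 1%:M by [].
apply/matrixP => i j; rewrite !mxE !big_ord_recl big_ord0 !mxE.
by case: i => [[|[|//]] ?]; case: j => [[|[|//]] ?] /=; rewrite ?mulr1n ?mulr0n -?ee /e /det; ring.
Qed.

Lemma coprime_dvd1 (d a b : int) : coprimez a b -> (d %| a)%Z -> (d %| b)%Z -> (d %| 1)%Z.
Proof.
by move=> /eqP e da db; have := dvdz_gcd d a b; rewrite da db e.
Qed.

(** The primitive [v] is completed to a lattice basis [v], [z] with [w] equal to [l] times [z] minus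
    [k] times [v]. A common divisor of [l] and [k] divides the primitive [w], and [k = 1] would make
    the primitive [v + w] divisible by [l]. *)
Lemma l_reflexive_code l P : (1 < l)%N -> l_reflexive l P ->
  exists C k, [/\ C \in models, (k < l)%N, coprime l k, k != 1%N & has_code l P C k].
Proof.
move=> l1 hP; have l0 : (0 < l)%N by apply: ltnW.
have [r hr] := l_reflexive_set l0 hP.
have [C [v [w [CM dvw [cv cw cvw] Sx]]]] := reflexive_model hr.
have /coprimezP[[p q] /= pq] := cv.
pose z0 : vec := (- q, p).
have d0 : det v z0 = 1 by rewrite -pq /det /=; ring.
pose a := det w z0.
have w1 : w.1 = a * v.1 + det v w * z0.1.
  by rewrite -[LHS]mulr1 -d0 /a /det; ring.
have w2 : w.2 = a * v.2 + det v w * z0.2.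
  by rewrite -[LHS]mulr1 -d0 /a /det; ring.
pose e := Num.sg (det v w).
have dE : det v w = l%:Z * e by rewrite -dvw mulrC -numEsg.
(* Shifting [z] by multiples of [v] reduces the coefficient [- a] modulo [l], and the sign [e] of
   [det v w] is absorbed into [z]. *)
pose k := `|(- a %% l%:Z)%Z|%N; pose t := (- a %/ l%:Z)%Z.
have lz : l%:Z != 0 by rewrite eqz_nat -lt0n.
have kE : k%:Z = (- a %% l%:Z)%Z by rewrite /k gez0_abs // modz_ge0.
have aE : a = - (t * l%:Z + k%:Z) by rewrite kE -divz_eq opprK.
pose z : vec := (e * z0.1 - t * v.1, e * z0.2 - t * v.2).
have z1 : w.1 = l%:Z * z.1 - k%:Z * v.1 by rewrite w1 dE aE /=; ring.
have z2 : w.2 = l%:Z * z.2 - k%:Z * v.2 by rewrite w2 dE aE /=; ring.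
have dz : `|det v z| = 1.
  have -> : det v z = e * det v z0 by rewrite /det /=; ring.
  by rewrite d0 mulr1 normr_sg -normr_eq0 dvw lz.
clearbody z.
have one d : (d %| 1)%Z -> `|d|%N = 1%N by rewrite dvdz1 => /eqP.
exists C, k; split=> //.
- by rewrite -ltz_nat kE ltz_pmod // ltz_nat.
- apply/eqP/(one (gcdn l k)%:Z)/(coprime_dvd1 cw).
    by rewrite z1 rpredB // dvdz_mulr // dvdzE /= ?dvdn_gcdl ?dvdn_gcdr.
  by rewrite z2 rpredB // dvdz_mulr // dvdzE /= ?dvdn_gcdl ?dvdn_gcdr.
- apply/eqP => k1; have := one l%:Z (coprime_dvd1 cvw _ _).
  rewrite z1 z2 k1 !mul1r ![_ + (_ - _)]addrC !subrK !dvdz_mulr //.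
  by move=> /(_ isT isT) /= le; rewrite le in l1.
- exists (mx2 v z); first exact: mx2_unit.
  have cE c : comb v w c = comb v z (skew l k c).
    by rewrite /comb /ray /skew /= z1 z2; congr pair; ring.
  apply/seteqP; split=> x /=.
    move=> hx; have : vertex P (toQ (col2 (x 0 0, x 1 0))) by rewrite col2K.
    move=> /Sx/mapP[c cC xE]; exists c => //.
    by rewrite mx2_col2 -cE -xE col2K.
  move=> [c cC <-]; rewrite mx2_col2 -cE; apply/Sx.
  exact: map_f.
Qed.

Local Close Scope ring_scope.

Theorem corollary1p5 (l : nat) (l_gt1 : (1 < l)%N) :
  iso_classes l #<= `I_(16 * (totient l - 1)).
Proof.
(* As [1 < l], the residue 1 occurs in the list, so its removal lowers the size [totient l] by
   one. *)
pose K := rem 1%N [seq k <- iota 0 l | coprime l k].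
pose L := [seq (C, k) | C <- models, k <- K].
have sizeL : size L = (16 * (totient l - 1))%N.
  rewrite size_allpairs size_rem ?mem_filter ?coprimen1 ?mem_iota //.
  rewrite size_filter subn1 totient_count_coprime -sum1_count /index_iota subn0.
  by congr (16 * _.-1)%N; rewrite [LHS]big_mkcond.
(* Sets with equal codes are isomorphic, so each class is the value of [F] at the code of any of its
   representatives. Codes that no set has are sent to the empty set. *)
pose F (x : seq vec * nat) : set (set 'cV[rat]_2) :=
  [set Q | l_reflexive l Q /\ exists2 P, has_code l P x.1 x.2 & isomorphic P Q].
apply: (@card_le_trans _ _ _ ((fun i => F (nth ([::], 0%N) L i)) @` `I_(size L))); last first.
  by rewrite -sizeL; exact: card_image_le.
apply: subset_card_le => _ [P hP <-].
have [C [k [CM kl ckl k1 hC]]] := l_reflexive_code l_gt1 hP.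
have CkL : (C, k) \in L.
  apply: allpairs_f => //.
  by rewrite mem_rem_uniq ?filter_uniq ?iota_uniq // !inE k1 mem_filter ckl mem_iota.
exists (index (C, k) L); first by rewrite /= index_mem.
rewrite nth_index //; apply/seteqP; split=> Q [hQ].
  by move=> [P' hP' PQ]; split=> //; apply: isomorphic_trans PQ; apply: has_code_isomorphic hC hP'.
by move=> PQ; split=> //; exists P.
Qed.
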